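(* Let $\delta>0$, $\alpha\in(0,2)$ and $\alpha_0\in(0,1)$, and suppose that $$\limsup_{|x|\to\infty}\bigg[\Big(\sup_{|z|\ge |x|}e^{-V(z)}\Big)e^{\delta|x|}|x|^{d+\alpha-\alpha_0}\bigg]=0.$$ Then there exists a constant $C_1>0$ such that for all $f\in C_b^\infty(\mathbb R^d)$, $$\int\big(f(x)-\mu_V(f)\big)^2\frac{e^{V(x)-\delta|x|}}{(1+|x|)^{d+\alpha}}\,\mu_V(dx)\le C_1 D_{\alpha,V,\delta}(f,f).$$
   Context: Let $d\ge1$. $V:\mathbb R^d\to\mathbb R$ is a locally bounded measurable function such that $e^{-V}$ is bounded and $\int e^{-V(x)}dx<\infty$; $\mu_V(dx)=\frac{e^{-V(x)}}{\int e^{-V(y)}dy}dx$, and $\mu_V(f)=\int f\,d\mu_V$. $C_b^\infty(\mathbb R^d)$ is the set of smooth functions on $\mathbb R^d$ that are bounded together with all their derivatives. For $\alpha\in(0,2)$, $\delta\ge0$, $$D_{\alpha,V,\delta}(f,f):=\iint\frac{(f(y)-f(x))^2}{|y-x|^{d+\alpha}}e^{-\delta|y-x|}\,dy\,\mu_V(dx).$$ *)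

(* Defs.v *)
From HB Require Import structures.
From mathcomp Require Import all_boot all_order all_algebra.
From mathcomp Require Import all_classical all_reals all_analysis.
Set Implicit Arguments. Unset Strict Implicit. Unset Printing Implicit Defensive.
Import Order.TTheory GRing.Theory Num.Theory.
Import numFieldNormedType.Exports.
Local Open Scope classical_set_scope.
Local Open Scope ring_scope.

(* Points of R^d are represented as d-tuples of reals; d.-tuple R carries the
   product (= Borel) sigma-algebra provided by MathComp-Analysis. *)

Section Defs.
Variable R : realType.

Definition enorm d (x : d.-tuple R) : R :=
  Num.sqrt (\sum_(i < d) tnth x i ^+ 2).

Definition edist d (x y : d.-tuple R) : R :=
  Num.sqrt (\sum_(i < d) (tnth y i - tnth x i) ^+ 2).

(* Lebesgue integral over R^d of a nonnegative (extended-real-valued)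
   function, as the iterated one-dimensional Lebesgue integral
   (equal to the integral w.r.t. d-dimensional Lebesgue measure for
   nonnegative measurable functions, by Tonelli). *)
Fixpoint lint (d : nat) : (d.-tuple R -> \bar R) -> \bar R :=
  match d return (d.-tuple R -> \bar R) -> \bar R with
  | 0 => fun f => f [tuple]
  | d'.+1 => fun f =>
      (\int[@lebesgue_measure R]_x lint (fun t : d'.-tuple R => f (cons_tuple x t)))%E
  end.

Definition ZV d (V : d.-tuple R -> R) : R :=
  fine (lint (fun x => (expR (- V x))%:E)).

Definition muV d (V : d.-tuple R -> R) (g : d.-tuple R -> R) : R :=
  (fine (lint (fun x => (Num.max (g x) 0 * expR (- V x))%:E))
   - fine (lint (fun x => (Num.max (- g x) 0 * expR (- V x))%:E))) / ZV V.

Definition shift d (x : d.-tuple R) (i : 'I_d) (s : R) : d.-tuple R :=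
  [tuple tnth x j + (if j == i then s else 0) | j < d].

Definition partial d (i : 'I_d) (f : d.-tuple R -> R) : d.-tuple R -> R :=
  fun x => derive1 (fun s => f (shift x i s)) 0.

Fixpoint iter_partial d (l : seq 'I_d) (f : d.-tuple R -> R) : d.-tuple R -> R :=
  match l with
  | [::] => f
  | i :: l' => partial i (iter_partial l' f)
  end.

(* f in C_b^infty(R^d): all partial derivatives of all orders exist
   everywhere and are bounded (this forces them to be continuous). *)
Definition Cb_infty d (f : d.-tuple R -> R) : Prop :=
  forall l : seq 'I_d,
    (forall x (i : 'I_d), derivable (fun s => iter_partial l f (shift x i s)) 0 1)
    /\ exists M : R, forall x, `|iter_partial l f x| <= M.

Definition Dform d (alpha : R) (V : d.-tuple R -> R) (delta : R)
    (f : d.-tuple R -> R) : \bar R :=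
  lint (fun x =>
    (lint (fun y => ((f y - f x) ^+ 2 / (edist x y `^ (d%:R + alpha))
                     * expR (- (delta * edist x y)))%:E)
     * (expR (- V x) / ZV V)%:E)%E).

Definition tailsup d (V : d.-tuple R -> R) (x : d.-tuple R) : R :=
  sup [set expR (- V z) | z in [set z | enorm x <= enorm z]].

End Defs.

(* Main.v *)
Require Import Defs.
From HB Require Import structures.
From mathcomp Require Import all_boot all_order all_algebra.
From mathcomp Require Import all_classical all_reals all_analysis.
From mathcomp Require Import measurable_realfun ring lra.
Import Order.TTheory GRing.Theory Num.Theory.
Import numFieldNormedType.Exports.
Local Open Scope classical_set_scope.
Local Open Scope ring_scope.

(* Put w(x) = e^{-delta|x|} / (1+|x|)^{d+alpha}, q = e^{-V} and
   G(y) = int (f(x) - f(y))^2 w(x) dx.  The left-hand side is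
   Z^{-1} int (f - mu_V(f))^2 w.  The tail hypothesis gives
   q <= C e^{-delta|x|}, so q^2 / w is integrable, and Cauchy-Schwarz yields
     (f(y) - mu_V(f))^2 <= Z^{-2} (int |f - f(y)| q)^2
                        <= Z^{-2} (int q^2 / w) G(y).
   Hence int (f - mu_V(f))^2 w <= K G(y) for every y.  Multiplying by
   w(y) q(y) and integrating in y gives the claim, because
   w(x) w(y) <= e^{-delta|x-y|} / |x-y|^{d+alpha}, by |x-y| <= |x|+|y|. *)

(** * The iterated Lebesgue integral: measurability in parameters, monotonicity, linearity,
    positivity, integrable exponentials *)

Section lint_theory.
Context {R : realType}.
Implicit Types n : nat.
Local Open Scope ereal_scope.

Lemma measurable_cons_pair dT (T : measurableType dT) n :
  measurable_fun setT (fun z : (T * R) * n.-tuple R =>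
    (z.1.1, [tuple of z.1.2 :: z.2])).
Proof.
apply/measurable_fun_pairP; split => /=.
  exact: measurableT_comp measurable_fst measurable_fst.
apply: measurable_cons; last exact: measurable_snd.
exact: measurableT_comp measurable_snd measurable_fst.
Qed.

Lemma lint_ge0 n (f : n.-tuple R -> \bar R) :
  (forall x, 0 <= f x) -> 0 <= lint f.
Proof.
elim: n f => [|n IH] f f0 /=; first exact: f0.
by apply: integral_ge0 => x _; apply: IH.
Qed.

(** The parameter space varies in the induction: peeling off one coordinate turns [T] into [T * R],
    and one-variable Tonelli then integrates that coordinate out. *)
Lemma measurable_lint_section dT (T : measurableType dT) n
    (f : T * n.-tuple R -> \bar R) :
  measurable_fun setT f -> (forall x, 0 <= f x) ->
  measurable_fun setT (fun t => lint (fun x => f (t, x))).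
Proof.
elim: n dT T f => [|n IH] dT T f mf f0 /=.
  by apply: measurableT_comp mf _; apply: measurable_pair2.
have m1 := IH _ (T * R)%type
  (fun z => f (z.1.1, [tuple of z.1.2 :: z.2])) _ _.
apply: (@measurable_fun_fubini_tonelli_F _ _ T (measurableTypeR R) R
  lebesgue_measure (fun z => lint (fun t => f (z.1, [tuple of z.2 :: t])))).
- apply: m1 => //; apply: measurableT_comp mf _; exact: measurable_cons_pair.
- by move=> z; apply: lint_ge0.
Qed.

Lemma measurable_cons_section n (f : n.+1.-tuple R -> \bar R) (s : R) :
  measurable_fun setT f -> measurable_fun setT (fun t => f (cons_tuple s t)).
Proof.
move=> mf; apply: measurableT_comp mf _.
exact: (@measurable_cons _ _ _ _ (fun=> s) n id).
Qed.

Lemma measurable_lint_cons n (f : n.+1.-tuple R -> \bar R) :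
  measurable_fun setT f -> (forall x, 0 <= f x) ->
  measurable_fun setT (fun s => lint (fun t => f (cons_tuple s t))).
Proof.
move=> mf f0; apply: (measurable_lint_section _ R n
  (fun z => f (cons_tuple z.1 z.2))) => //.
apply: measurableT_comp mf _.
exact: (@measurable_cons _ _ _ _ fst n snd measurable_fst measurable_snd).
Qed.

(* The integrand of [Dform] then never has to be shown measurable. *)
Lemma ge0_le_integral_unmeasurable dT (T : measurableType dT)
    (mu : {measure set T -> \bar R}) (f g : T -> \bar R) :
  (forall x, 0 <= f x) -> (forall x, f x <= g x) ->
  \int[mu]_x f x <= \int[mu]_x g x.
Proof.
move=> f0 fg; have g0 x : 0 <= g x by apply: le_trans (f0 x) (fg x).
(* The integral of a nonnegative function is a supremum over the simple functions below it, and a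
   larger function has more of these. *)
rewrite !ge0_integralTE//; apply: ereal_sup_le => _ [h hf <-].
by exists h => // x; apply: le_trans (hf x) (fg x).
Qed.

Lemma le_lint n (f g : n.-tuple R -> \bar R) :
  (forall x, 0 <= f x) -> (forall x, f x <= g x) -> lint f <= lint g.
Proof.
elim: n f g => [|n IH] f g f0 fg /=; first exact: fg.
apply: ge0_le_integral_unmeasurable.
- by move=> x; apply: lint_ge0.
- by move=> x; apply: IH.
Qed.

Lemma lintD n (f g : n.-tuple R -> \bar R) :
  measurable_fun setT f -> measurable_fun setT g ->
  (forall x, 0 <= f x) -> (forall x, 0 <= g x) ->
  lint (fun x => f x + g x) = lint f + lint g.
Proof.
elim: n f g => [//|n IH] f g mf mg f0 g0 /=.
rewrite -ge0_integralD//.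
- apply: eq_integral => x _; apply: IH => //; exact: measurable_cons_section.
- by move=> x _; apply: lint_ge0.
- exact: measurable_lint_cons.
- by move=> x _; apply: lint_ge0.
- exact: measurable_lint_cons.
Qed.

Lemma lintZl n (k : \bar R) (f : n.-tuple R -> \bar R) :
  measurable_fun setT f -> (forall x, 0 <= f x) -> 0 <= k ->
  lint (fun x => k * f x) = k * lint f.
Proof.
move=> + + k0; elim: n f => [//|n IH] f mf f0 /=.
rewrite -ge0_integralZl//.
- apply: eq_integral => x _; apply: IH => //; exact: measurable_cons_section.
- exact: measurable_lint_cons.
- by move=> x _; apply: lint_ge0.
Qed.

(** If the integral were zero, the inner integral, positive by induction, would vanish almost
    everywhere. The whole line would then be null, although it contains an interval of length 1. *)
Lemma lint_gt0 n (f : n.-tuple R -> \bar R) :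
  measurable_fun setT f -> (forall x, 0 < f x) -> 0 < lint f.
Proof.
elim: n f => [|n IH] f mf f0 /=; first exact: f0.
set g := fun s : R => lint (fun t => f (cons_tuple s t)).
have g0 s : 0 < g s by apply: IH => //; exact: measurable_cons_section.
rewrite lt_neqAle integral_ge0 ?andbT; last by move=> x _; apply/ltW/g0.
apply/eqP => /esym ig0.
have mg : measurable_fun setT g by apply: measurable_lint_cons => // x; apply/ltW.
have := (ae_eq_integral_abs lebesgue_measure measurableT mg).1.
under eq_integral do rewrite gee0_abs ?ltW//.
move=> /(_ ig0) [N [mN N0 sub]].
have NT : N = setT.
  rewrite -subTset => x _; apply: sub => /= /(_ I) gx.
  by have := g0 x; rewrite gx ltxx.
move: N0; rewrite NT => T0.
have : (lebesgue_measure `[0%R, 1%R]%classic <= lebesgue_measure (@setT R)).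
  by apply: le_measure => //; rewrite inE//.
rewrite T0 lebesgue_measure_itv/= lte_fin ltr01 sube0 lee_fin.
by rewrite leNgt ltr01.
Qed.

(** By symmetry this is twice the integral over the half-line, where the integrand is [c^-1] times
    the exponential density of rate [c]. *)
Lemma integral_expR_abs_lty (c : R) : (0 < c)%R ->
  \int[@lebesgue_measure R]_s (expR (- (c * `|s|)))%:E < +oo.
Proof.
move=> c0.
have cf : continuous (fun s : R => expR (- (c * `|s|))).
  move=> x; apply: (@continuous_comp _ _ _ (fun s : R => - (c * `|s|))%R expR);
    last exact: continuous_expR.
  apply: continuousN; apply: continuousM; first exact: cst_continuous.
  exact: norm_continuous.
rewrite ge0_symfun_integralT//=.
- apply: lte_mul_pinfty => //.
  apply: (@le_lt_trans _ _ (\int[lebesgue_measure]_x (c^-1%:E * (exponential_pdf c x)%:E))).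
    rewrite integral_mkcond/=.
    apply: ge0_le_integral_unmeasurable => x.
      by rewrite patchE; case: ifP => // _; rewrite lee_fin expR_ge0.
    rewrite patchE; case: ifPn => [|_].
      rewrite inE/= => x0; rewrite exponential_pdfE// -EFinM lee_fin.
      by rewrite ger0_norm// mulrA mulVf ?gt_eqF// mul1r mulNr.
    by rewrite -EFinM lee_fin mulr_ge0 ?exponential_pdf_ge0 ?invr_ge0 ?ltW.
  rewrite ge0_integralZl//.
  + by rewrite integral_exponential_pdf// mule1 ltry.
  + by apply/measurable_EFinP; exact: measurable_exponential_pdf.
  + by move=> x _; rewrite lee_fin exponential_pdf_ge0 ?ltW.
  + by rewrite lee_fin invr_ge0 ltW.
- by move=> x /=; rewrite normrN.
Qed.

(** With the l1 norm in the exponent the integrand is a product over the coordinates, so the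
    iterated integral factorises. *)
Lemma lint_expR_sum_abs_lty n (c : R) : (0 < c)%R ->
  lint (fun x : n.-tuple R =>
    (expR (- (c * \sum_(i < n) `|tnth x i|)))%:E) < +oo.
Proof.
move=> c0; elim: n => [|n IH] /=.
  by rewrite ltry.
set J := lint _ in IH.
have J0 : 0 <= J by apply: lint_ge0 => x; rewrite lee_fin expR_ge0.
have mJ : measurable_fun setT (fun x : n.-tuple R =>
    (expR (- (c * \sum_(i < n) `|tnth x i|)))%:E).
  apply/measurable_EFinP; apply: measurableT_comp => //.
  apply: measurableT_comp => //; apply: measurable_funM => //.
  apply: measurable_sum => i; apply: measurableT_comp => //.
  exact: measurable_tnth.
rewrite (_ : \int[_]_x _ = \int[lebesgue_measure]_s (J * (expR (- (c * `|s|)))%:E)); last first.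
  apply: eq_integral => s _; rewrite muleC -lintZl//.
  congr lint; apply/funext => x; rewrite -EFinM -expRD -opprD -mulrDr.
  rewrite big_ord_recl/= tnth0; do 5 f_equal.
  by apply: eq_bigr => i _; rewrite tnthS.
rewrite ge0_integralZl//.
- by apply: lte_mul_pinfty; [|rewrite fin_num_abs gee0_abs|exact: integral_expR_abs_lty].
- apply/measurable_EFinP; apply: measurableT_comp => //.
  by apply: measurableT_comp => //; apply: measurable_funM => //.
Qed.

End lint_theory.

(** * Measurability of functions that are continuous along each coordinate axis *)

Section separate_continuity.
Context {R : realType}.

Lemma floor_grid_cvg (s : R) :
  (fun n : nat => (Num.floor (n.+1%:R * s))%:~R / n.+1%:R : R) @ \oo --> s.
Proof.
apply/cvgrPdist_le => e e0.
near=> n.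
set t := n.+1%:R * s.
have n0 : 0 < n.+1%:R :> R by rewrite ltr0n.
have h1 : (Num.floor t)%:~R <= t by exact: floor_le.
have h2 : t < (Num.floor t + 1)%:~R by exact: floorD1_gt.
have sE : s = t / n.+1%:R by rewrite /t mulrAC divff ?mul1r// gt_eqF.
rewrite [X in X - _]sE -mulrBl normrM [X in _ * X]ger0_norm ?invr_ge0 ?ltW//.
rewrite ger0_norm ?subr_ge0//.
have h3 : n.+1%:R^-1 < e.
  by near: n; exact: near_infty_natSinv_lt (PosNum e0).
apply: le_lt_trans h3; apply: ler_piMl; first by rewrite invr_ge0 ltW.
by rewrite lerBlDl; rewrite intrD in h2; exact: ltW.
Unshelve. all: by end_near. Qed.

(* [g] is the pointwise limit of its discretisations in the second variable. *)
Lemma measurable_fun_caratheodory dT (T : measurableType dT)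
    (g : T * R -> R) :
  (forall s, measurable_fun setT (fun t => g (t, s))) ->
  (forall t, continuous (fun s => g (t, s))) ->
  measurable_fun setT g.
Proof.
move=> mg cg.
pose r (n : nat) (s : R) : R := (Num.floor (n.+1%:R * s))%:~R / n.+1%:R.
apply: (measurable_fun_cvg (h := fun n z => g (z.1, r n z.2))); last first.
  move=> [t s] _ /=.
  apply: (cvg_comp (fun n => r n s) (fun s => g (t, s))); last exact: cg.
  exact: floor_grid_cvg.
move=> n _ B mB; rewrite setTI.
pose h (k : int) : R := k%:~R / n.+1%:R.
(* For fixed [n] the discretisation sees the second variable only through the integer [k], so the
   preimage is a countable union of measurable rectangles. *)
have -> : (fun z : T * R => g (z.1, r n z.2)) @^-1` B =
    \bigcup_(k in @setT int) (((fun t => g (t, h k)) @^-1` B) `*`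
      [set s | Num.floor (n.+1%:R * s) = k]).
  apply/seteqP; split => [[t s] /= gB|[t s] [k _ [/= gB sk]]].
    by exists (Num.floor (n.+1%:R * s)).
  by rewrite /r sk.
apply: countable_bigcupT_measurable => // k; apply: measurableX.
  by rewrite -[X in measurable X]setTI; exact: mg.
rewrite (_ : [set s | _] = `[h k, h (k + 1)[%classic).
  exact: measurable_itv.
have n0 : 0 < n.+1%:R :> R by rewrite ltr0n.
apply/seteqP; split => s /=; rewrite in_itv/= /h ler_pdivrMr// ltr_pdivlMr//.
  by move=> <-; rewrite mulrC floor_le floorD1_gt.
by rewrite mulrC => /floor_def.
Qed.

(** Induction on [n], with the first coordinate absorbed into the parameter space.
    [measurable_fun_caratheodory] supplies measurability in the enlarged parameter, by continuity
    along that coordinate. *)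
Lemma measurable_fun_separately_continuous dT (T : measurableType dT) n
    (f : T * n.-tuple R -> R) :
  (forall y, measurable_fun setT (fun t => f (t, y))) ->
  (forall t y i, f (t, Defs.shift y i s) @[s --> (0 : R)] --> f (t, y)) ->
  measurable_fun setT f.
Proof.
elim: n dT T f => [|n IH] dT T f mf cf.
  rewrite (_ : f = (fun t => f (t, [tuple])) \o fst).
    exact: measurableT_comp (mf _) measurable_fst.
  by apply/funext => -[t y] /=; rewrite [y]tuple0.
have shift_cons0 a (y : n.-tuple R) s :
    Defs.shift (cons_tuple a y) ord0 s = cons_tuple (a + s) y.
  apply: eq_from_tnth => i; rewrite tnth_mktuple.
  by case: (unliftP ord0 i) => [j|] ->; rewrite ?tnthS ?tnth0//= addr0.
have shift_consS a (y : n.-tuple R) i s :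
    Defs.shift (cons_tuple a y) (lift ord0 i) s = cons_tuple a (Defs.shift y i s).
  apply: eq_from_tnth => j; rewrite tnth_mktuple.
  case: (unliftP ord0 j) => [k|] ->; last by rewrite !tnth0 addr0.
  by rewrite !tnthS tnth_mktuple (inj_eq lift_inj).
pose g (z : (T * R) * n.-tuple R) := f (z.1.1, cons_tuple z.1.2 z.2).
have mg : measurable_fun setT g.
  apply: IH => [y|[t a] y i].
    apply: (measurable_fun_caratheodory _ _
      (fun z : T * R => f (z.1, cons_tuple z.2 y))) => [s|t s].
      exact: (mf (cons_tuple s y)).
    have := cvg_comp_shift s 0 (fun s => f (t, cons_tuple s y)); rewrite add0r.
    move=> E; have := cf t (cons_tuple s y) ord0.
    under eq_fun do rewrite shift_cons0 [s + _]addrC.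
    by rewrite [X in X --> _ -> _]E.
  rewrite /g/=; have := cf t (cons_tuple a y) (lift ord0 i).
  by under eq_fun do rewrite shift_consS.
rewrite (_ : f = g \o (fun z => ((z.1, thead z.2), [tuple of behead z.2]))); last first.
  by apply/funext => -[t y] /=; rewrite /g/= {1}(tuple_eta y).
apply: measurableT_comp mg _.
apply/measurable_fun_pairP; split => /=.
  apply/measurable_fun_pairP; split => /=; first exact: measurable_fst.
  apply: (measurableT_comp (f := fun y : n.+1.-tuple R => thead y)); last exact: measurable_snd.
  exact: measurable_tnth.
apply: (measurableT_comp (f := fun y : n.+1.-tuple R => [tuple of behead y])); last exact: measurable_snd.
exact: measurable_behead.
Qed.

(** The definition of [Cb_infty] gives derivatives along the axes, hence separate continuity;
    measurability follows from this without passing through joint continuity. *)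
Lemma Cb_infty_measurable n (f : n.-tuple R -> R) :
  Cb_infty f -> measurable_fun setT f.
Proof.
move=> /(_ [::])[df _].
(* A dummy real parameter fits the previous lemma; fixing it at 0 removes it again. *)
have : measurable_fun setT (fun z : R * n.-tuple R => f z.2).
  apply: measurable_fun_separately_continuous => [y|t y i]; first exact: (measurable_cst (f y)).
  have y0 : Defs.shift y i 0 = y.
    by apply: eq_from_tnth => j; rewrite tnth_mktuple; case: ifP; rewrite addr0.
  rewrite -[X in _ --> f X]y0.
  exact: differentiable_continuous ((derivable1_diffP _ _).1 (df y i)).
move=> mf.
have := measurableT_comp mf (pair1_measurable (0 : R)). apply.
Qed.

End separate_continuity.

(** * The Euclidean norm: Cauchy-Schwarz, the triangle inequality and integrable exponentials *)

Section euclidean.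
Context {R : realType} {d : nat}.
Implicit Types x y : d.-tuple R.

Lemma enorm_ge0 x : 0 <= enorm x.
Proof. exact: sqrtr_ge0. Qed.

Lemma sqr_enorm x : enorm x ^+ 2 = \sum_(i < d) tnth x i ^+ 2.
Proof. by rewrite sqr_sqrtr// sumr_ge0// => i _; exact: sqr_ge0. Qed.

Lemma ler_abs_enorm x i : `|tnth x i| <= enorm x.
Proof.
rewrite -(@ler_pXn2r _ 2)// ?nnegrE ?enorm_ge0// sqr_enorm real_normK ?num_real//.
by rewrite (bigD1 i)//= lerDl sumr_ge0// => j _; exact: sqr_ge0.
Qed.

Lemma ler_sum_abs_enorm x : \sum_(i < d) `|tnth x i| <= d%:R * enorm x.
Proof.
apply: le_trans (ler_sum _ (fun i _ => ler_abs_enorm x i)) _.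
by rewrite sumr_const card_ord mulr_natl.
Qed.

Lemma edist_eq0 x y : Defs.edist x y = 0 -> x = y.
Proof.
move=> /eqP; rewrite sqrtr_eq0 => le0; apply: eq_from_tnth => i.
apply/eqP; rewrite eq_sym -subr_eq0 -sqrf_eq0 eq_le sqr_ge0 andbT.
apply: le_trans le0; rewrite [leRHS](bigD1 i)//= lerDl sumr_ge0// => j _.
exact: sqr_ge0.
Qed.

(** With [a = |x|] and [b = |y|], the sum of the squares [(b x_i + a y_i)^2] equals [2ab(ab + s)].
    This lower half of Cauchy-Schwarz is what bounds [|y - x|^2] by [(|x| + |y|)^2]. *)
Lemma cauchy_schwarz_ge x y :
  - (enorm x * enorm y) <= \sum_(i < d) tnth x i * tnth y i.
Proof.
set a := enorm x; set b := enorm y; set s := \sum_(i < d) _.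
have a0 : 0 <= a := enorm_ge0 x; have b0 : 0 <= b := enorm_ge0 y.
have abs0 : 0 <= a * b * (a * b + s).
  suff -> : a * b * (a * b + s) =
      (\sum_(i < d) (b * tnth x i + a * tnth y i) ^+ 2) / 2.
    by rewrite divr_ge0// sumr_ge0// => i _; exact: sqr_ge0.
  have -> : \sum_(i < d) (b * tnth x i + a * tnth y i) ^+ 2 =
      b ^+ 2 * a ^+ 2 + a ^+ 2 * b ^+ 2 + 2 * a * b * s.
    rewrite [X in _ * X + _]sqr_enorm [X in _ + _ * X + _]sqr_enorm.
    rewrite !mulr_sumr -!big_split/=.
    by apply: eq_bigr => i _; ring.
  by field.
have [ab0|ab0] := eqVneq (a * b) 0; last first.
  have abp : 0 < a * b by rewrite lt_neqAle eq_sym ab0 mulr_ge0.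
  by move: abs0; rewrite pmulr_rge0// addrC -lerBlDr sub0r.
(* If [ab = 0], no division is possible, but one of the vectors is zero and every term of the sum
   vanishes. *)
rewrite ab0 oppr0 /s big1// => i _.
move/eqP : ab0; rewrite mulf_eq0 => /orP[] /eqP n0.
- have := ler_abs_enorm x i; rewrite -/a n0 normr_le0 => /eqP ->.
  by rewrite mul0r.
- have := ler_abs_enorm y i; rewrite -/b n0 normr_le0 => /eqP ->.
  by rewrite mulr0.
Qed.

Lemma edist_le x y : Defs.edist x y <= enorm x + enorm y.
Proof.
rewrite -(@ler_pXn2r _ 2)// ?nnegrE ?sqrtr_ge0 ?addr_ge0 ?enorm_ge0//.
rewrite sqr_sqrtr; last by rewrite sumr_ge0// => i _; exact: sqr_ge0.
have -> : \sum_(i < d) (tnth y i - tnth x i) ^+ 2 =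
    enorm x ^+ 2 + enorm y ^+ 2 - 2 * \sum_(i < d) tnth x i * tnth y i.
  rewrite !sqr_enorm mulr_sumr -sumrN -!big_split/=.
  by apply: eq_bigr => i _; ring.
have := cauchy_schwarz_ge x y.
rewrite sqrrD; lra.
Qed.

Lemma measurable_enorm : measurable_fun setT (@enorm R d).
Proof.
apply: measurableT_comp; first exact: (continuous_measurable_fun (@sqrt_continuous R)).
by apply: measurable_sum => i; apply: measurable_funX; exact: measurable_tnth.
Qed.

Lemma lint_expR_enorm_lty (c : R) : 0 < c ->
  (lint (fun x : d.-tuple R => (expR (- (c * enorm x)))%:E) < +oo)%E.
Proof.
(* The l1 norm is at most [d] times the Euclidean one; dividing by [d.+1] instead of [d] keeps the
   rate positive in dimension 0. *)
move=> c0; have cd0 : 0 < c / d.+1%:R by rewrite divr_gt0.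
apply: le_lt_trans (lint_expR_sum_abs_lty d _ cd0).
apply: le_lint => x; rewrite lee_fin ?expR_ge0// ler_expR lerN2.
rewrite mulrAC ler_pdivrMr// -mulrA ler_pM2l//.
apply: le_trans (ler_sum_abs_enorm x) _.
by rewrite mulrC ler_wpM2l ?enorm_ge0// ler_nat.
Qed.

End euclidean.

(** * Auxiliary facts on powers and reciprocals *)

(** Raise [t <= e^t] to the power [p] at [t = (c / p)(1 + s)]. This yields the constant
    [(p / c)^p e^c]; the case [p = 0] is separate because of the division. *)
Lemma powR1D_le_expR (R : realType) (p c : R) : 0 <= p -> 0 < c ->
  exists2 C : R, 0 < C & forall s, 0 <= s -> (1 + s) `^ p <= C * expR (c * s).
Proof.
rewrite le_eqVlt => /predU1P[<-|p0] c0.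
  exists 1 => // s s0; rewrite powRr0 mul1r -expR0 ler_expR mulr_ge0// ltW//.
exists ((p / c) `^ p * expR c); first by rewrite mulr_gt0 ?expR_gt0// powR_gt0// divr_gt0.
move=> s s0; rewrite -mulrA -expRD.
have cp0 : 0 < c / p by rewrite divr_gt0.
have -> : 1 + s = (p / c) * (c / p * (1 + s)).
  by field; rewrite !gt_eqF.
have t0 : 0 <= c / p * (1 + s) by rewrite mulr_ge0 ?(ltW cp0)// addr_ge0.
rewrite powRM//; last by rewrite divr_ge0// ltW.
rewrite ler_wpM2l ?powR_ge0//.
apply: (@le_trans _ _ (expR (c / p * (1 + s)) `^ p)).
  rewrite ge0_ler_powR ?nnegrE ?expR_ge0 ?(ltW p0)//.
  by apply: le_trans (expR_ge1Dx _); rewrite lerDr.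
rewrite -expRM ler_expR le_eqVlt; apply/orP; left; apply/eqP.
by field; rewrite gt_eqF.
Qed.

Lemma measurable_funV_ge0 dT (T : measurableType dT) (R : realType)
    (u : T -> R) : measurable_fun setT u -> (forall x, 0 <= u x) ->
  measurable_fun setT (fun x => (u x)^-1).
Proof.
move=> mu u0; under eq_fun do rewrite -powR_inv1//.
exact: (measurableT_comp (measurable_powR (-1)) mu).
Qed.

(** * Integrals of real functions: Cauchy-Schwarz and the distance from a constant to the mean *)

Section real_valued_lint.
Context {R : realType} {d : nat}.
Implicit Types u v : d.-tuple R -> R.

Lemma lint_EFinD u v :
  measurable_fun setT u -> measurable_fun setT v ->
  (forall x, 0 <= u x) -> (forall x, 0 <= v x) ->
  lint (fun x => (u x + v x)%:E) =
  (lint (fun x => (u x)%:E) + lint (fun x => (v x)%:E))%E.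
Proof.
move=> mu mv u0 v0; under [in LHS]eq_fun do rewrite EFinD.
by apply: lintD => //; apply/measurable_EFinP.
Qed.

Lemma lint_EFinZl k u :
  measurable_fun setT u -> (forall x, 0 <= u x) -> 0 <= k ->
  lint (fun x => (k * u x)%:E) = (k%:E * lint (fun x => (u x)%:E))%E.
Proof.
move=> mu u0 k0; under [in LHS]eq_fun do rewrite EFinM.
by apply: lintZl => //; apply/measurable_EFinP.
Qed.

Lemma le_lint_EFin u v : (forall x, 0 <= u x) -> (forall x, u x <= v x) ->
  (lint (fun x => (u x)%:E) <= lint (fun x => (v x)%:E))%E.
Proof. by move=> u0 uv; apply: le_lint => x; rewrite lee_fin. Qed.

(** Domination turns an extended-real integral into a named real number, so that later estimates are
    plain real arithmetic. *)
Lemma lint_EFin_fin k u v :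
  measurable_fun setT v -> (forall x, 0 <= u x) -> (forall x, 0 <= v x) ->
  0 <= k -> (forall x, u x <= k * v x) ->
  (lint (fun x => (v x)%:E) < +oo)%E ->
  exists2 a, 0 <= a & lint (fun x => (u x)%:E) = a%:E.
Proof.
move=> mv u0 v0 k0 uv vy.
have fu : lint (fun x => (u x)%:E) \is a fin_num.
  rewrite ge0_fin_numE; last by apply: lint_ge0 => x; rewrite lee_fin.
  apply: le_lt_trans (le_lint_EFin _ _ u0 uv) _; rewrite lint_EFinZl//.
  by apply: lte_mul_pinfty; rewrite ?lee_fin.
exists (fine (lint (fun x => (u x)%:E))); last by rewrite fineK.
by apply: fine_ge0; apply: lint_ge0 => x; rewrite lee_fin.
Qed.

(* Cauchy-Schwarz, obtained by integrating
   [2 a g q <= A g^2 w + (a^2 / A) (q^2 / w)]. *)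
Lemma sqr_lint_le (g q w : d.-tuple R -> R) (a G A : R) :
  measurable_fun setT g -> measurable_fun setT q -> measurable_fun setT w ->
  (forall x, 0 <= g x) -> (forall x, 0 <= q x) -> (forall x, 0 < w x) ->
  0 < A ->
  lint (fun x => (g x * q x)%:E) = a%:E ->
  lint (fun x => (g x ^+ 2 * w x)%:E) = G%:E ->
  lint (fun x => (q x ^+ 2 / w x)%:E) = A%:E ->
  a ^+ 2 <= A * G.
Proof.
move=> mg mq mw g0 q0 w0 A0 aE GE AE.
have a0 : 0 <= a.
  by rewrite -lee_fin -aE; apply: lint_ge0 => x; rewrite lee_fin mulr_ge0.
have mgq : measurable_fun setT (fun x => g x * q x) by apply: measurable_funM.
have mg2 : measurable_fun setT (fun x => g x ^+ 2 * w x).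
  by apply: measurable_funM => //; apply: measurable_funX.
have mq2 : measurable_fun setT (fun x => q x ^+ 2 / w x).
  apply: measurable_funM; first exact: measurable_funX.
  by apply: measurable_funV_ge0 => // x; exact: ltW.
have g20 x : 0 <= g x ^+ 2 * w x by rewrite mulr_ge0 ?sqr_ge0 ?ltW.
have q20 x : 0 <= q x ^+ 2 / w x by rewrite mulr_ge0 ?sqr_ge0 ?invr_ge0 ?ltW.
have := le_lint_EFin (fun x => 2 * a * (g x * q x))
  (fun x => A * (g x ^+ 2 * w x) + a ^+ 2 / A * (q x ^+ 2 / w x)).
have c0 : 0 <= a ^+ 2 / A by rewrite divr_ge0 ?sqr_ge0 ?ltW.
have A0' := ltW A0.
rewrite lint_EFinD; first last.
- by move=> x; rewrite mulr_ge0.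
- by move=> x; rewrite mulr_ge0.
- exact: measurable_funM.
- exact: measurable_funM.
rewrite !lint_EFinZl ?mulr_ge0 ?invr_ge0//; last by move=> x; rewrite mulr_ge0.
rewrite aE GE AE -!EFinM -EFinD lee_fin => H.
have {}H : 2 * a * a <= A * G + a ^+ 2 / A * A.
  apply: H => x; first by rewrite !mulr_ge0.
  have wx := w0 x; rewrite -subr_ge0.
  (* The difference of the two integrands is a perfect square over [A w]. *)
  have -> : A * (g x ^+ 2 * w x) + a ^+ 2 / A * (q x ^+ 2 / w x)
      - 2 * a * (g x * q x) = (A * g x * w x - a * q x) ^+ 2 / (A * w x).
    by field; rewrite !gt_eqF.
  by rewrite divr_ge0 ?sqr_ge0// mulr_ge0 ?(ltW A0) ?ltW.
(* The integrated inequality now reads [2 a^2 <= A G + a^2]. *)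
rewrite mulfVK ?gt_eqF// in H.
by move: H; rewrite expr2; lra.
Qed.

(** [(muV V f - c) * ZV V] is the integral of [(f - c) e^{-V}], whose modulus is at most the
    integral of [|f - c| e^{-V}]. *)
Lemma muV_dist_le (V f : d.-tuple R -> R) (c a M : R) :
  measurable_fun setT V -> measurable_fun setT f -> (forall x, `|f x| <= M) ->
  (lint (fun x => (expR (- V x))%:E) < +oo)%E -> 0 < ZV V ->
  lint (fun x => (`|f x - c| * expR (- V x))%:E) = a%:E ->
  `|c - muV V f| * ZV V <= a.
Proof.
move=> mV mf fM Zy Z0 aE.
set q := fun x => expR (- V x).
have q0 x : 0 <= q x by exact: expR_ge0.
have mq : measurable_fun setT q.
  by apply: measurableT_comp => //; exact: measurableT_comp.
pose fp x := Num.max (f x) 0; pose fn x := Num.max (- f x) 0.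
have mfp : measurable_fun setT fp by exact: measurable_maxr.
have mfn : measurable_fun setT fn.
  by apply: measurable_maxr => //; exact: measurableT_comp.
have fp0 x : 0 <= fp x by rewrite le_max lexx orbT.
have fn0 x : 0 <= fn x by rewrite le_max lexx orbT.
have M0 : 0 <= M by apply: le_trans (fM [tuple 0 | _ < d]).
have ZE : lint (fun x => (q x)%:E) = (ZV V)%:E.
  by rewrite /ZV fineK// ge0_fin_numE//; apply: lint_ge0 => x; rewrite lee_fin.
have [P P0 PE] : exists2 P, 0 <= P & lint (fun x => (fp x * q x)%:E) = P%:E.
  apply: (lint_EFin_fin M _ q) => // x; first by rewrite mulr_ge0.
  by rewrite ler_wpM2r// ge_max M0 andbT; apply: le_trans (fM x); exact: ler_norm.
have [N N0 NE] : exists2 N, 0 <= N & lint (fun x => (fn x * q x)%:E) = N%:E.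
  apply: (lint_EFin_fin M _ q) => // x; first by rewrite mulr_ge0.
  rewrite ler_wpM2r// ge_max M0 andbT; apply: le_trans (fM x).
  by rewrite -normrN; exact: ler_norm.
have mE : muV V f = (P - N) / ZV V.
  by rewrite /muV (_ : lint _ = P%:E)// (_ : lint _ = N%:E).
pose g x := `|f x - c|.
have mg : measurable_fun setT g.
  by apply: measurableT_comp => //; exact: measurable_funB.
have g0 x : 0 <= g x by exact: normr_ge0.
(* The integrals below are of nonnegative functions only, so the sign of [c]
   is split off. *)
pose cp := Num.max c 0; pose cn := Num.max (- c) 0.
have cp0 : 0 <= cp by rewrite le_max lexx orbT.
have cn0 : 0 <= cn by rewrite le_max lexx orbT.
have cE : c = cp - cn.
  by rewrite /cp /cn; case: (lerP c 0); case: (lerP (- c) 0); lra.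
have fE x : f x = fp x - fn x.
  by rewrite /fp /fn; case: (lerP (f x) 0); case: (lerP (- f x) 0); lra.
have mfg u v : measurable_fun setT u -> measurable_fun setT v ->
    measurable_fun setT (fun x : d.-tuple R => u x * v x : R).
  exact: measurable_funM.
have sumE (u : d.-tuple R -> R) k U : measurable_fun setT u -> (forall x, 0 <= u x) -> 0 <= k ->
    lint (fun x => (u x * q x)%:E) = U%:E ->
    lint (fun x => (u x * q x + k * q x)%:E) = (U + k * ZV V)%:E.
  move=> mu u0 k0 UE; rewrite lint_EFinD ?lint_EFinZl ?UE ?ZE//.
  - exact: mfg.
  - exact: measurable_funM.
  - by move=> x; rewrite mulr_ge0.
  - by move=> x; rewrite mulr_ge0.
(* Integrates [f - c <= |f - c|], with the negative parts moved across so that every integrand is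
   nonnegative; [le2] does the same for [c - f]. *)
have le1 : P + cn * ZV V <= N + cp * ZV V + a.
  rewrite -lee_fin -(sumE fp)// EFinD -(sumE fn)// -aE -lint_EFinD; last 4 first.
  - by apply: measurable_funD; exact: measurable_funM.
  - exact: mfg.
  - by move=> x; rewrite addr_ge0// mulr_ge0.
  - by move=> x; rewrite mulr_ge0.
  apply: le_lint_EFin => x; first by rewrite addr_ge0// mulr_ge0.
  rewrite -!mulrDl ler_wpM2r//.
  have := ler_norm (f x - c); have := fE x; lra.
have le2 : N + cp * ZV V <= P + cn * ZV V + a.
  rewrite -lee_fin -(sumE fn)// EFinD -(sumE fp)// -aE -lint_EFinD; last 4 first.
  - by apply: measurable_funD; exact: measurable_funM.
  - exact: mfg.
  - by move=> x; rewrite addr_ge0// mulr_ge0.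
  - by move=> x; rewrite mulr_ge0.
  apply: le_lint_EFin => x; first by rewrite addr_ge0// mulr_ge0.
  rewrite -!mulrDl ler_wpM2r//.
  have := lerNnormlW (lexx `|f x - c|); have := fE x; lra.
rewrite -[X in _ * X](gtr0_norm Z0) -normrM mulrBl mE mulfVK ?gt_eqF//.
by rewrite ler_norml; apply/andP; split; rewrite cE; lra.
Qed.

End real_valued_lint.

(** * The weight: its action on deviations from the mean, its comparison with the jump kernel, and
    the decay of the density *)

Lemma powR_ge1 (R : realType) (p a : R) : 0 <= p -> 1 <= a -> 1 <= a `^ p.
Proof.
move=> p0 a1; have := @ge0_ler_powR R p p0 1 a.
by rewrite !nnegrE powR1; apply => //; exact: le_trans ler01 a1.
Qed.

Section weights.
Context {R : realType} {d : nat}.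

(** With [m] the mean, [(f - m)^2 <= 2 (f - c)^2 + 2 (c - m)^2], and [muV_dist_le] with
    Cauchy-Schwarz bounds [(c - m)^2] by [A G / Z^2]. The constant is the same for all [c], which
    later runs over the values of [f]. *)
Lemma deviation_from_mean_le (V w f : d.-tuple R -> R) (M W A : R) :
  measurable_fun setT V -> measurable_fun setT w -> measurable_fun setT f ->
  (forall x, 0 < w x) -> (forall x, `|f x| <= M) ->
  (lint (fun x => (expR (- V x))%:E) < +oo)%E -> 0 < ZV V ->
  lint (fun x => (w x)%:E) = W%:E -> 0 < A ->
  lint (fun x => (expR (- V x) ^+ 2 / w x)%:E) = A%:E ->
  exists2 I, lint (fun x => ((f x - muV V f) ^+ 2 * w x)%:E) = I%:E &
  forall c, `|c| <= M -> exists2 G,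
    lint (fun x => ((f x - c) ^+ 2 * w x)%:E) = G%:E &
    I <= (2 + 2 * A * W / ZV V ^+ 2) * G.
Proof.
move=> mV mw mf w0 fM Zy Z0 WE A0 AE.
have Wy : (lint (fun x => (w x)%:E) < +oo)%E by rewrite WE ltry.
have W0 : 0 <= W.
  by rewrite -lee_fin -WE; apply: lint_ge0 => x; rewrite lee_fin ltW.
have M0 : 0 <= M by apply: le_trans (fM [tuple 0 | _ < d]).
have mg c : measurable_fun setT (fun x => `|f x - c|).
  by apply: measurableT_comp => //; exact: measurable_funB.
have mfc c : measurable_fun setT (fun x => (f x - c) ^+ 2 * w x).
  by apply: measurable_funM => //; apply: measurable_funX; exact: measurable_funB.
have fc0 c x : 0 <= (f x - c) ^+ 2 * w x by rewrite mulr_ge0 ?sqr_ge0 ?ltW.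
have fin c : exists2 G, 0 <= G & lint (fun x => ((f x - c) ^+ 2 * w x)%:E) = G%:E.
  apply: (lint_EFin_fin ((M + `|c|) ^+ 2) _ w) => // [x||x]; first exact: ltW.
    by rewrite sqr_ge0.
  rewrite ler_wpM2r ?(ltW (w0 x))// -real_normK ?num_real// ler_pXn2r ?nnegrE ?addr_ge0//.
  by apply: le_trans (ler_normB _ _) _; rewrite lerD2r.
have mq : measurable_fun setT (fun x => expR (- V x)).
  by apply: measurableT_comp => //; exact: measurableT_comp.
have [I I0 IE] := fin (muV V f); exists I => // c cM.
have [G G0 GE] := fin c; exists G => //.
have [a a0 aE] : exists2 a, 0 <= a &
    lint (fun x => (`|f x - c| * expR (- V x))%:E) = a%:E.
  have M20 : 0 <= M + M by rewrite addr_ge0.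
  apply: (lint_EFin_fin (M + M) _ (fun x => expR (- V x))) => // x.
  rewrite ler_wpM2r ?expR_ge0//.
  by apply: le_trans (ler_normB _ _) _; rewrite lerD.
have h1 := muV_dist_le V f c a M mV mf fM Zy Z0 aE.
have h2 : a ^+ 2 <= A * G.
  apply: (sqr_lint_le (fun x => `|f x - c|) (fun x => expR (- V x)) w) => //.
  by rewrite -GE; congr lint; apply/funext => x; rewrite real_normK ?num_real.
set m := muV V f in IE h1 *.
have h3 : (c - m) ^+ 2 <= A * G / ZV V ^+ 2.
  rewrite ler_pdivlMr ?exprn_gt0//; apply: le_trans h2.
  rewrite -exprMn -real_normK ?num_real// ler_pXn2r ?nnegrE//.
  by rewrite normrM (gtr0_norm Z0).
have h4 : I <= 2 * G + 2 * (c - m) ^+ 2 * W.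
  have k0 : 0 <= 2 * (c - m) ^+ 2 by rewrite mulr_ge0 ?sqr_ge0.
  have H := le_lint_EFin (fun x => (f x - m) ^+ 2 * w x)
    (fun x => 2 * ((f x - c) ^+ 2 * w x) + 2 * (c - m) ^+ 2 * w x) (fc0 m).
  rewrite IE lint_EFinD in H; first last.
  - by move=> x; rewrite mulr_ge0 ?(ltW (w0 x)).
  - by move=> x; rewrite mulr_ge0.
  - exact: measurable_funM.
  - exact: measurable_funM.
  rewrite !lint_EFinZl// in H; last by move=> x; exact: ltW.
  rewrite GE WE -!EFinM -EFinD lee_fin in H; apply: H => x.
  rewrite mulrA -mulrDl ler_wpM2r ?(ltW (w0 x))//.
  have := sqr_ge0 ((f x - c) - (c - m)); rewrite !expr2; lra.
apply: le_trans h4 _; rewrite [leRHS]mulrDl lerD2l.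
have := ler_wpM2r W0 (ler_wpM2l (ler0n R 2) h3) => /le_trans; apply.
by rewrite le_eqVlt; apply/orP; left; apply/eqP; field; rewrite gt_eqF.
Qed.

Definition weight (delta p : R) (x : d.-tuple R) : R :=
  expR (- (delta * enorm x)) / (1 + enorm x) `^ p.

Lemma weight_gt0 delta p x : 0 < weight delta p x.
Proof.
by rewrite divr_gt0 ?expR_gt0// powR_gt0// ltr_pwDl ?enorm_ge0.
Qed.

Lemma measurable_weight delta p : measurable_fun setT (weight delta p).
Proof.
apply: measurable_funM.
  apply: measurableT_comp => //; apply: measurableT_comp => //.
  by apply: measurable_funM => //; exact: measurable_enorm.
apply: measurable_funV_ge0 => [|x]; last exact: powR_ge0.
apply: (measurableT_comp (measurable_powR p)).
by apply: measurable_funD => //; exact: measurable_enorm.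
Qed.

Lemma powR1D_enorm_ge1 p (x : d.-tuple R) : 0 <= p -> 1 <= (1 + enorm x) `^ p.
Proof.
by move=> p0; rewrite powR_ge1// lerDl enorm_ge0.
Qed.

Lemma weight_le delta p x : 0 <= p ->
  weight delta p x <= expR (- (delta * enorm x)).
Proof.
move=> p0; rewrite ler_pdivrMr; last first.
  by apply: lt_le_trans (powR1D_enorm_ge1 _ x p0).
by rewrite ler_peMr ?expR_ge0// powR1D_enorm_ge1.
Qed.

(** The exponentials compare by [|x - y| <= |x| + |y|], the powers by
    [|x - y| <= (1 + |x|)(1 + |y|)]. On the diagonal with [p > 0] the right-hand side would be 0, by
    the convention [0^-1 = 0]. *)
Lemma weightM_le_kernel delta p (x y : d.-tuple R) : 0 <= delta -> 0 <= p ->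
  Defs.edist x y != 0 ->
  weight delta p x * weight delta p y <=
  (Defs.edist x y `^ p)^-1 * expR (- (delta * Defs.edist x y)).
Proof.
move=> delta0 p0 xy0.
have e0 : 0 < Defs.edist x y by rewrite lt_neqAle eq_sym xy0 sqrtr_ge0.
have nx := enorm_ge0 x; have ny := enorm_ge0 y.
have exy := edist_le x y.
rewrite /weight mulrACA -expRD -invfM -powRM ?addr_ge0// mulrC ler_pM//.
- by rewrite invr_ge0 powR_ge0.
- rewrite lef_pV2 ?posrE ?powR_gt0// ?mulr_gt0 ?ltr_pwDl//.
  rewrite ge0_ler_powR ?nnegrE ?mulr_ge0 ?addr_ge0 ?(ltW e0)//.
  apply: le_trans exy _; have := mulr_ge0 nx ny; lra.
- by rewrite ler_expR -opprD lerN2 -mulrDr ler_wpM2l.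
Qed.

(** Far out, the tail condition at [e = 1] gives [e^{-V} <= e^{-delta|x|}]; on the remaining ball
    the bound [M] is multiplied by [e^{delta rho}] to offset the decay. The constant adds the two
    cases. *)
Lemma density_le (V : d.-tuple R -> R) (delta p : R) :
  0 <= delta -> 0 <= p -> (exists M, forall x, expR (- V x) <= M) ->
  (forall e, 0 < e -> exists r, forall x, r <= enorm x ->
     tailsup V x * expR (delta * enorm x) * enorm x `^ p <= e) ->
  exists2 C, 0 < C & forall x, expR (- V x) <= C * expR (- (delta * enorm x)).
Proof.
move=> delta0 p0 [M VM] tail.
have [r rP] := tail 1 ltr01.
have M0 : 0 < M by apply: lt_le_trans (VM [tuple 0 | _ < d]); exact: expR_gt0.
pose rho := Num.max r 1.
exists (1 + M * expR (delta * rho)).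
  by rewrite ltr_pwDl// mulr_ge0 ?expR_ge0 ?ltW.
move=> x; rewrite mulrDl mul1r; have [rx|xr] := leP rho (enorm x).
  apply: ler_wpDr; first by rewrite !mulr_ge0 ?expR_ge0 ?ltW.
  move: rx; rewrite ge_max => /andP[rx x1].
  (* Boundedness of [e^{-V}] makes [sup] a true supremum; on an unbounded set it defaults to 0. *)
  have Vs : expR (- V x) <= tailsup V x.
    apply: ub_le_sup; last by exists x => //=.
    by exists M => _ [z _ <-].
  have xp : 1 <= enorm x `^ p by exact: powR_ge1.
  rewrite [leRHS]expRN -[leRHS]mul1r ler_pdivlMr ?expR_gt0//.
  apply: le_trans (rP x rx); apply: (@le_trans _ _ (tailsup V x * expR (delta * enorm x))).
    by rewrite ler_wpM2r ?expR_ge0.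
  rewrite ler_peMr// mulr_ge0 ?expR_ge0//.
  exact: le_trans (expR_ge0 _) Vs.
apply: ler_wpDl; first exact: expR_ge0.
rewrite -mulrA -expRD; apply: le_trans (VM x) _; rewrite ler_peMr ?(ltW M0)//.
rewrite -expR0 ler_expR subr_ge0 ler_wpM2l// ltW//.
Qed.

End weights.

(** The integrand is at most [C^2 e^{-delta|x|} (1 + |x|)^p]. Half of the exponential absorbs the
    power and the other half is integrable. Positivity of [A] allows the division by [A] in
    Cauchy-Schwarz. *)
Lemma lint_sqr_div_weight_fin (R : realType) d (V : d.-tuple R -> R)
    (delta p C : R) :
  measurable_fun setT V -> 0 < delta -> 0 <= p -> 0 < C ->
  (forall x, expR (- V x) <= C * expR (- (delta * enorm x))) ->
  exists2 A, 0 < A &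
    lint (fun x => (expR (- V x) ^+ 2 / weight delta p x)%:E) = A%:E.
Proof.
move=> mV delta0 p0 C0 VC.
have [K K0 powK] := powR1D_le_expR R p (delta / 2) p0 (divr_gt0 delta0 (ltr0n R 2)).
have mq : measurable_fun setT (fun x => expR (- V x)).
  by apply: measurableT_comp => //; exact: measurableT_comp.
have mqw : measurable_fun setT (fun x => expR (- V x) ^+ 2 / weight delta p x).
  apply: measurable_funM; first exact: measurable_funX.
  apply: measurable_funV_ge0 => [|x]; first exact: measurable_weight.
  exact/ltW/weight_gt0.
have qw0 x : 0 < expR (- V x) ^+ 2 / weight delta p x.
  by rewrite divr_gt0 ?exprn_gt0 ?expR_gt0 ?weight_gt0.
have me : measurable_fun setT (fun x : d.-tuple R => expR (- (delta / 2 * enorm x))).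
  apply: measurableT_comp => //; apply: measurableT_comp => //.
  by apply: measurable_funM => //; exact: measurable_enorm.
have [A A0 AE] : exists2 A, 0 <= A &
    lint (fun x => (expR (- V x) ^+ 2 / weight delta p x)%:E) = A%:E.
  apply: (lint_EFin_fin (C ^+ 2 * K) _ (fun x => expR (- (delta / 2 * enorm x)))) => //.
  - by move=> x; exact: ltW.
  - by rewrite mulr_ge0 ?sqr_ge0 ?ltW.
  - move=> x; have nx := enorm_ge0 x.
    have pw0 : 0 < (1 + enorm x) `^ p by rewrite powR_gt0// ltr_pwDl.
    apply: (@le_trans _ _ ((C * expR (- (delta * enorm x))) ^+ 2 / weight delta p x)).
      rewrite ler_wpM2r ?invr_ge0 ?(ltW (weight_gt0 _ _ _))//.
      rewrite ler_pXn2r// ?nnegrE ?expR_ge0//.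
      by apply: le_trans (VC x); exact: expR_ge0.
    have -> : (C * expR (- (delta * enorm x))) ^+ 2 / weight delta p x =
        C ^+ 2 * expR (- (delta * enorm x)) * (1 + enorm x) `^ p.
      by rewrite /weight; field; rewrite !gt_eqF ?expR_gt0.
    rewrite -mulrA -[leRHS]mulrA ler_wpM2l ?sqr_ge0//.
    apply: le_trans (ler_wpM2l (expR_ge0 _) (powK _ nx)) _.
    rewrite mulrCA -expRD ler_wpM2l ?(ltW K0)// ler_expR; lra.
  - by apply: lint_expR_enorm_lty; rewrite divr_gt0.
exists A => //; rewrite -lte_fin -AE; apply: lint_gt0 => [|x].
  exact/measurable_EFinP.
by rewrite lte_fin.
Qed.

(** * The weighted Poincaré inequality, by integrating the deviation estimate over its centre *)

Theorem theorem1p1 (R : realType) (d : nat) (V : d.-tuple R -> R)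
  (delta alpha alpha0 : R) :
  (1 <= d)%N ->
  measurable_fun setT V ->
  (* V locally bounded *)
  (forall r : R, exists M : R, forall x, enorm x <= r -> `|V x| <= M) ->
  (* e^{-V} bounded *)
  (exists M : R, forall x, expR (- V x) <= M) ->
  (* int e^{-V} < oo *)
  (lint (fun x => (expR (- V x))%:E) < +oo)%E ->
  0 < delta -> 0 < alpha < 2 -> 0 < alpha0 < 1 ->
  (* limsup_{|x| -> oo} [ (sup_{|z|>=|x|} e^{-V(z)}) e^{delta|x|} |x|^{d+alpha-alpha0} ] = 0,
     the bracket being nonnegative *)
  (forall e : R, 0 < e -> exists r : R, forall x, r <= enorm x ->
     tailsup V x * expR (delta * enorm x) * enorm x `^ (d%:R + alpha - alpha0) <= e) ->
  exists C1 : R, 0 < C1 /\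
    forall f : d.-tuple R -> R, Cb_infty f ->
      (lint (fun x =>
         ((f x - muV V f) ^+ 2
          * (expR (V x - delta * enorm x) / (1 + enorm x) `^ (d%:R + alpha))
          * (expR (- V x) / ZV V))%:E)
       <= C1%:E * Dform alpha V delta f)%E.
Proof.
move=> d1 mV _ Vbdd Zy delta0 /andP[alpha0p _] /andP[_ alpha01] tail.
have d1R : 1 <= d%:R :> R by rewrite (ler_nat R 1 d).
set p := d%:R + alpha.
have p0 : 0 <= p by rewrite addr_ge0// ltW.
have [C C0 VC] : exists2 C, 0 < C &
    forall x, expR (- V x) <= C * expR (- (delta * enorm x)).
  (* The exponent [d + alpha - alpha0] is nonnegative because [alpha0 < 1 <= d]. *)
  apply: density_le tail => //; first exact: ltW.
  by rewrite subr_ge0 (le_trans (ltW alpha01))// (le_trans d1R)// lerDl ltW.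
have [A A0 AE] := lint_sqr_div_weight_fin R d V delta p C mV delta0 p0 C0 VC.
set w := weight delta p in AE.
have w0 : forall x, 0 < w x := weight_gt0 delta p.
have mw : measurable_fun setT w := measurable_weight delta p.
have mq : measurable_fun setT (fun x => expR (- V x)).
  by apply: measurableT_comp => //; exact: measurableT_comp.
have q0 x : 0 <= expR (- V x) by exact: expR_ge0.
have Z0 : 0 < ZV V.
  apply: fine_gt0; rewrite Zy andbT; apply: lint_gt0; first exact/measurable_EFinP.
  by move=> x; rewrite lte_fin expR_gt0.
have [W W0 WE] : exists2 W, 0 <= W & lint (fun x => (w x)%:E) = W%:E.
  apply: (lint_EFin_fin 1 _ (fun x => expR (- (delta * enorm x)))) => //.
  - apply: measurableT_comp => //; apply: measurableT_comp => //.
    by apply: measurable_funM => //; exact: measurable_enorm.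
  - by move=> x; exact: ltW.
  - by move=> x; rewrite mul1r; exact: weight_le.
  - exact: lint_expR_enorm_lty.
have mwq : measurable_fun setT (fun x => w x * expR (- V x)) by exact: measurable_funM.
have [B B0 BE] : exists2 B, 0 < B & lint (fun x => (w x * expR (- V x))%:E) = B%:E.
  have [B _ BE] : exists2 B, 0 <= B & lint (fun x => (w x * expR (- V x))%:E) = B%:E.
    apply: (lint_EFin_fin 1 _ (fun x => expR (- V x))) => // x.
      by rewrite mulr_ge0// ltW.
    rewrite ler_wpM2r//; apply: le_trans (weight_le delta p x p0) _.
    by rewrite -expR0 ler_expR oppr_le0 mulr_ge0 ?enorm_ge0// ltW.
  exists B => //; rewrite -lte_fin -BE; apply: lint_gt0; first exact/measurable_EFinP.
  by move=> x; rewrite lte_fin mulr_gt0 ?expR_gt0.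
set K := 2 + 2 * A * W / ZV V ^+ 2.
have K0 : 0 < K.
  by rewrite ltr_pwDl// divr_ge0 ?sqr_ge0 ?mulr_ge0 ?(ltW A0).
(* The left-hand side will equal [I / Z], and the form will be at least [I B / (K Z)]; neither [K]
   nor [B] depends on [f]. *)
exists (K / B); split; first by rewrite divr_gt0.
move=> f Cf; have mf := Cb_infty_measurable _ _ Cf.
have [M fM] := (Cf [::]).2; rewrite /= in fM.
have [I IE HI] := deviation_from_mean_le V w f M W A mV mw mf w0 fM Zy Z0 WE A0 AE.
have mdev c : measurable_fun setT (fun x => (f x - c) ^+ 2 * w x).
  by apply: measurable_funM => //; apply: measurable_funX; exact: measurable_funB.
have dev0 c x : 0 <= (f x - c) ^+ 2 * w x by rewrite mulr_ge0 ?sqr_ge0 ?ltW.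
have I0 : 0 <= I by rewrite -lee_fin -IE; apply: lint_ge0 => x; rewrite lee_fin.
(* The factor [e^V] cancels the density of [muV], leaving the weight [w] and [1 / Z]. *)
have -> : lint (fun x => ((f x - muV V f) ^+ 2
          * (expR (V x - delta * enorm x) / (1 + enorm x) `^ p)
          * (expR (- V x) / ZV V))%:E) = ((ZV V)^-1 * I)%:E.
  rewrite EFinM -IE -lint_EFinZl ?invr_ge0 ?(ltW Z0)//; congr lint.
  apply/funext => x; congr EFin.
  rewrite expRD [expR (- V x)]expRN /w /weight; field.
  by rewrite !gt_eqF ?expR_gt0 ?powR_gt0// ltr_pwDl ?enorm_ge0.
have Dge : ((I / K / ZV V * B)%:E <= Dform alpha V delta f)%E.
  rewrite EFinM -BE -lint_EFinZl ?divr_ge0 ?(ltW K0) ?(ltW Z0)//; last first.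
    by move=> x; rewrite mulr_ge0// ltW.
  apply: le_lint => x.
    rewrite lee_fin; apply: mulr_ge0; last by rewrite mulr_ge0 ?(ltW (w0 x)).
    by rewrite !divr_ge0 ?(ltW K0) ?(ltW Z0).
  rewrite (_ : I / K / ZV V * (w x * expR (- V x)) =
    I / K * w x * (expR (- V x) / ZV V)); last by ring.
  rewrite [leLHS]EFinM lee_wpmul2r ?lee_fin ?divr_ge0 ?(ltW Z0)//.
  (* The centre is the value of [f] at the outer variable, so [G] becomes the inner integral of the
     form with kernel [w]. *)
  have [G GE IG] := HI (f x) (fM x).
  apply: (@le_trans _ _ (w x * G)%:E).
    by rewrite lee_fin mulrC ler_wpM2l ?(ltW (w0 x))// ler_pdivrMr// mulrC.
  rewrite EFinM -GE -lint_EFinZl ?(ltW (w0 x))//.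
  apply: le_lint_EFin => y; first by rewrite mulr_ge0 ?(ltW (w0 x)).
  have [/edist_eq0 ->|xy0] := eqVneq (Defs.edist x y) 0.
    by rewrite subrr expr0n/= !mul0r mulr0.
  rewrite mulrCA -mulrA ler_wpM2l ?sqr_ge0//.
  exact: weightM_le_kernel (ltW delta0) p0 xy0.
apply: le_trans (lee_wpmul2l _ Dge); last by rewrite lee_fin divr_ge0 ?ltW.
rewrite -EFinM lee_fin le_eqVlt; apply/orP; left; apply/eqP.
by field; rewrite !gt_eqF.
Qed.
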